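(* Let $F$ be a graph, let $r\ge 2$ be an integer, and let $\mathcal{H}$ be an $r$-uniform Berge-$F$-free hypergraph. Then there exists an $F$-free red-blue graph $G$ on the vertex set of $\mathcal{H}$ such that \[|\mathcal{H}| \leq g_r(G) = e(G_{\mathrm{red}}) + \mathcal{N}(K_r,G_{\mathrm{blue}}),\] where $|\mathcal{H}|$ denotes the number of hyperedges of $\mathcal{H}$.
   Context: All graphs and hypergraphs are finite and simple (no repeated edges or hyperedges). A hypergraph $\mathcal{H}$ contains a Berge-$F$ (Berge copy of the graph $F$) if there are an injection $\varphi:V(F)\to V(\mathcal{H})$ and an injection $f:E(F)\to E(\mathcal{H})$ with $\{\varphi(u),\varphi(v)\}\subset f(uv)$ for every edge $uv\in E(F)$; otherwise $\mathcal{H}$ is Berge-$F$-free. A graph is $F$-free if it has no (not necessarily induced) subgraph isomorphic to $F$. A red-blue graph is a graph $G$ each of whose edges is colored red or blue; it is $F$-free if its underlying uncolored graph is $F$-free. $G_{\mathrm{red}}$ and $G_{\mathrm{blue}}$ denote the graphs formed by the red and by the blue edges, $e(\cdot)$ is the number of edges, and $\mathcal{N}(K_r,G_{\mathrm{blue}})$ is the number of copies of $K_r$ in $G_{\mathrm{blue}}$. Put $g_r(G)=e(G_{\mathrm{red}})+\mathcal{N}(K_r,G_{\mathrm{blue}})$. *)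

(* Defs.v *)
(* MathComp, without the analysis libraries. *)
From mathcomp Require Import all_boot.

Set Implicit Arguments.
Unset Strict Implicit.
Unset Printing Implicit Defensive.

(* A hypergraph with vertex set V is given by its set of hyperedges, of type  *)
(* {set {set V}}; a (simple) graph is a 2-uniform hypergraph.  Isolated       *)
(* vertices are kept, since the vertex set is the whole finite type V.        *)

Definition uniform (V : finType) (r : nat) (H : {set {set V}}) : bool :=
  [forall e in H, #|e| == r].

Definition is_graph (V : finType) (G : {set {set V}}) : bool := uniform 2 G.

Definition complete_graph (n : nat) : {set {set 'I_n}} :=
  [set e : {set 'I_n} | #|e| == 2].

(* For an edge e = {u, v}, the image phi @: e is {phi u, phi v}. *)
Definition embedding (U V : finType) (F : {set {set U}}) (G : {set {set V}})
    (phi : {ffun U -> V}) : bool :=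
  injectiveb phi && [forall e in F, phi @: e \in G].

Definition contains_graph (U V : finType)
    (F : {set {set U}}) (G : {set {set V}}) : Prop :=
  exists phi : {ffun U -> V}, embedding F G phi.

(* The map f is total on {set U}, but only its values on the edges of F are   *)
(* constrained.                                                               *)
Definition contains_berge (U V : finType)
    (F : {set {set U}}) (H : {set {set V}}) : Prop :=
  exists (phi : U -> V) (f : {set U} -> {set V}),
    [/\ injective phi,
        {in F &, injective f},
        forall e, e \in F -> f e \in H &
        forall e, e \in F -> phi @: e \subset f e].

(* The subgraphs of G isomorphic to F, each recorded as the pair of its       *)
(* vertex set and its edge set; embeddings with the same image give the same  *)
(* copy.                                                                      *)
Definition copies (U V : finType) (F : {set {set U}}) (G : {set {set V}}) :
    {set {set V} * {set {set V}}} :=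
  [set (phi @: [set: U], [set phi @: (e : {set U}) | e in F])
     | phi : {ffun U -> V} & embedding F G phi].

Definition num_copies (U V : finType)
    (F : {set {set U}}) (G : {set {set V}}) : nat := #|copies F G|.

(* The colour of an edge e is red if rb_red e and blue otherwise; the value   *)
(* of rb_red on non-edges is irrelevant.                                      *)
Record rbgraph (V : finType) := RBGraph {
  rb_edges : {set {set V}};
  rb_edgesP : is_graph rb_edges;
  rb_red : pred {set V}
}.

Definition red_graph (V : finType) (G : rbgraph V) : {set {set V}} :=
  [set e in rb_edges G | rb_red G e].

Definition blue_graph (V : finType) (G : rbgraph V) : {set {set V}} :=
  [set e in rb_edges G | ~~ rb_red G e].

Definition g_ (V : finType) (r : nat) (G : rbgraph V) : nat :=
  #|red_graph G| + num_copies (complete_graph r) (blue_graph G).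

(* Main.v *)
Require Import Defs.
From mathcomp Require Import all_boot.
From mathcomp Require Import zify.

Set Implicit Arguments.
Unset Strict Implicit.
Unset Printing Implicit Defensive.

(* Join a pair of vertices e to a hyperedge h when e is contained in h.  By   *)
(* Koenig's theorem this bipartite graph has a matching M and a vertex cover  *)
(* B, D (B pairs, D hyperedges) of the same size.  Let G consist of the pairs *)
(* matched by M, those of B being blue: M turns every copy of F in G into a   *)
(* Berge copy.  By counting, B is included in G and G has |D| red edges, and  *)
(* a hyperedge outside D has all its pairs in B, so it spans a blue K_r.      *)

Section Koenig.

Variables Z X Y : finType.

(* Z is the edge set of a bipartite multigraph with endpoint maps s and t;    *)
(* this form makes the exchange of the two sides free.                        *)
Definition covers (s : Z -> X) (t : Z -> Y) (R : {set Z})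
    (B : {set X}) (D : {set Y}) : bool :=
  [forall p in R, (s p \in B) || (t p \in D)].

Lemma coversP (s : Z -> X) (t : Z -> Y) (R : {set Z}) (B : {set X})
    (D : {set Y}) :
  reflect (forall p, p \in R -> (s p \in B) || (t p \in D)) (covers s t R B D).
Proof. exact: forall_inP. Qed.

(* If s p = s q, combining covers (B1, D1) of R :\ p and (B2, D2) of R :\ q   *)
(* into (B1 :&: B2, D1 :|: D2) and (s p |: (B1 :|: B2), D1 :&: D2) yields two *)
(* covers of R whose sizes add up to at most 2k - 1.                          *)
Lemma critical_inj (s : Z -> X) (t : Z -> Y) (R : {set Z}) (k : nat) :
    (forall B D, covers s t R B D -> k <= #|B| + #|D|) ->
    (forall p, p \in R ->
       exists B D, covers s t (R :\ p) B D /\ #|B| + #|D| < k) ->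
  {in R &, injective s}.
Proof.
move=> minR critR p q pR qR spq; apply/eqP/negPn/negP => neq_pq.
have [B1 [D1 [/coversP cov1 lt1]]] := critR p pR.
have [B2 [D2 [/coversP cov2 lt2]]] := critR q qR.
have cov1' z : z \in R -> z != p -> (s z \in B1) || (t z \in D1).
  by move=> zR zp; apply: cov1; rewrite !inE zp.
have cov2' z : z \in R -> z != q -> (s z \in B2) || (t z \in D2).
  by move=> zR zq; apply: cov2; rewrite !inE zq.
(* Otherwise [(B1, D1)] would cover [p] too, hence all of [R], with total size below [k]. *)
have nB1 : s p \notin B1.
  apply/negP => spB; move: lt1; rewrite ltnNge minR //; apply/coversP => z zR.
  by have [->|/(cov1' z zR)//] := eqVneq z p; rewrite spB.
have nB2 : s p \notin B2.
  apply/negP => spB; move: lt2; rewrite ltnNge minR //; apply/coversP => z zR.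
  by have [->|/(cov2' z zR)//] := eqVneq z q; rewrite -spq spB.
have tpD2 : t p \in D2 by move: (cov2' p pR neq_pq); rewrite (negPf nB2).
have tqD1 : t q \in D1.
  by move: (cov1' q qR); rewrite eq_sym neq_pq -spq (negPf nB1) => /(_ isT).
have covI : covers s t R (B1 :&: B2) (D1 :|: D2).
  apply/coversP => z zR; rewrite !inE.
  have [->|zp] := eqVneq z p; first by rewrite tpD2 !orbT.
  have [->|zq] := eqVneq z q; first by rewrite tqD1 !orbT.
  by case/orP: (cov1' z zR zp) => ->; case/orP: (cov2' z zR zq) => ->;
    rewrite ?orbT.
have covU : covers s t R (s p |: (B1 :|: B2)) (D1 :&: D2).
  apply/coversP => z zR; rewrite !inE.
  have [->|zp] := eqVneq z p; first by rewrite eqxx.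
  have [->|zq] := eqVneq z q; first by rewrite spq eqxx.
  by case/orP: (cov1' z zR zp) => ->; case/orP: (cov2' z zR zq) => ->;
    rewrite ?orbT.
have := minR _ _ covU; rewrite cardsU1 !inE (negPf nB1) (negPf nB2) /=.
have := minR _ _ covI; have := cardsUI B1 B2; have := cardsUI D1 D2; lia.
Qed.

End Koenig.

Lemma coversC (Z X Y : finType) (s : Z -> X) (t : Z -> Y) (R : {set Z})
    (B : {set X}) (D : {set Y}) :
  covers s t R B D = covers t s R D B.
Proof. by apply: eq_forallb => p; rewrite orbC. Qed.

(** Shrink [R] to an inclusion-minimal [M] that still has no cover smaller than a minimum cover of
    [R]. Deleting any edge of [M] then allows a smaller cover, so [critical_inj], applied to each
    side in turn, makes [M] a matching. *)
Lemma koenig (Z X Y : finType) (s : Z -> X) (t : Z -> Y) (R : {set Z}) :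
  exists (M : {set Z}) (B : {set X}) (D : {set Y}),
    [/\ M \subset R, {in M &, injective s}, {in M &, injective t},
        covers s t R B D & #|B| + #|D| <= #|M|].
Proof.
pose size_of (c : {set X} * {set Y}) := #|c.1| + #|c.2|.
have covT : covers s t R [set: X] [set: Y].
  by apply/coversP => p _; rewrite !inE.
case: (@arg_minnP _ (setT, setT) (fun c => covers s t R c.1 c.2) size_of covT).
move=> [B0 D0] /= cov0 min0.
pose hard (M : {set Z}) := [forall c : {set X} * {set Y},
  covers s t M c.1 c.2 ==> (size_of (B0, D0) <= size_of c)].
have hardR : hard R by apply/forallP => c; apply/implyP/min0.
have [M /minsetP[/forallP hardM minM] subMR] := minset_exists hardR.
have hM B D : covers s t M B D -> #|B0| + #|D0| <= #|B| + #|D|.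
  by move=> cov; have /implyP := hardM (B, D); apply.
have cM p : p \in M ->
    exists B D, covers s t (M :\ p) B D /\ #|B| + #|D| < #|B0| + #|D0|.
  move=> pM; have : ~~ hard (M :\ p).
    apply/negP => /minM/(_ (subD1set _ _)) eqM.
    by move: pM; rewrite -eqM !inE eqxx.
  by rewrite negb_forall => /existsP[[B D]]; rewrite negb_imply -ltnNge
    => /andP[]; exists B, D.
exists M, B0, D0; split=> //; first exact: critical_inj hM cM.
  apply: (@critical_inj _ _ _ t s M (#|B0| + #|D0|)) => [D B|p pM].
    by rewrite coversC [leqRHS]addnC; apply: hM.
  have [B [D [cov ltBD]]] := cM p pM.
  by exists D, B; rewrite coversC addnC.
apply: leq_trans (leq_imset_card s M).
(* The [s]-endpoints of [M] alone cover [M], so they number at least [#|B0| + #|D0|]. *)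
have := hM (s @: M) set0; rewrite cards0 addn0; apply.
by apply/coversP => p pM; rewrite imset_f.
Qed.

Lemma contains_berge_of_matching (U V : finType) (F : {set {set U}})
    (G H : {set {set V}}) (f : {set V} -> {set V}) :
    {in G &, injective f} ->
    (forall e, e \in G -> f e \in H /\ e \subset f e) ->
  contains_graph F G -> contains_berge F H.
Proof.
move=> f_inj fP [phi /andP[/injectiveP phi_inj /forall_inP phiG]].
exists phi, (fun e : {set U} => f (phi @: e)).
split=> // [e1 e2 e1F e2F|e eF|e eF].
- by move/(f_inj _ _ (phiG _ e1F) (phiG _ e2F))/(imset_inj phi_inj).
- by have [] := fP _ (phiG _ eF).
- by have [] := fP _ (phiG _ eF).
Qed.

(** Each [h] in [N] is the vertex set of a copy of the complete graph, so the projection [fst] of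
    the copies reaches all of [N]. *)
Lemma clique_leq_num_copies (V : finType) (r : nat) (G N : {set {set V}}) :
    (forall h, h \in N -> #|h| = r) ->
    (forall h (e : {set V}), h \in N -> #|e| = 2 -> e \subset h -> e \in G) ->
  #|N| <= num_copies (complete_graph r) G.
Proof.
move=> cardN cliqueN.
apply: leq_trans (leq_imset_card fst (copies (complete_graph r) G)).
apply/subset_leq_card/subsetP => h hN.
have eq_r : r = #|h| by rewrite cardN.
pose phi := [ffun i : 'I_r => enum_val (cast_ord eq_r i)].
have phi_inj : injective phi.
  by move=> i j; rewrite !ffunE => /enum_val_inj/cast_ord_inj.
have phi_h i : phi i \in h by rewrite ffunE enum_valP.
have im_phi : phi @: setT = h.
  apply/eqP; rewrite eqEcard card_imset // cardsT card_ord -eq_r leqnn andbT.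
  by apply/subsetP => _ /imsetP[i _ ->].
apply/imsetP; exists (phi @: setT,
  [set phi @: (e : {set 'I_r}) | e in complete_graph r]) => //.
apply/imsetP; exists phi => //; rewrite inE; apply/andP; split.
  exact/injectiveP.
apply/forall_inP => e; rewrite inE => /eqP card_e.
apply: cliqueN hN _ _; first by rewrite card_imset.
by apply/subsetP => _ /imsetP[i _ ->].
Qed.

Theorem lemma2 (U V : finType) (F : {set {set U}}) (r : nat) (H : {set {set V}})
    (F_graph : is_graph F) (r_ge2 : 2 <= r)
    (H_uniform : uniform r H) (H_free : ~ contains_berge F H) :
  exists G : rbgraph V,
    ~ contains_graph F (rb_edges G) /\ #|H| <= g_ r G.
Proof.
pose R := [set p : {set V} * {set V} |
  [&& #|p.1| == 2, p.2 \in H & p.1 \subset p.2]].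
have [M [B [D [/subsetP subMR inj1 inj2 /coversP covR leM]]]] :=
  koenig fst snd R.
pose E := fst @: M.
(* The partner of [e] in the matching; the default [set0] is never taken on [E]. *)
pose f e := odflt set0 [pick h | (e, h) \in M].
have fM e : e \in E -> (e, f e) \in M.
  move=> /imsetP[[e' h] pM /= ->]; rewrite /f.
  by case: pickP => [//|/(_ h)]; rewrite pM.
have fP e : e \in E -> [/\ #|e| == 2, f e \in H & e \subset f e].
  by move=> /fM/subMR; rewrite inE => /and3P.
have f_inj : {in E &, injective f}.
  by move=> e1 e2 /fM e1M /fM e2M eq_f; have [] := inj2 _ _ e1M e2M eq_f.
have E_graph : is_graph E by apply/forall_inP => e /fP[].
have cardE : #|E| = #|M| by rewrite card_in_imset.
(* A matched pair outside [B] has its partner in [D], and partners are distinct. *)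
have leED : #|E :\: B| <= #|D|.
  rewrite -(@card_in_imset _ _ f) => [|e1 e2 /setDP[e1E _] /setDP[e2E _]];
    last exact: f_inj.
  apply/subset_leq_card/subsetP => _ /imsetP[e /setDP[eE eB] ->].
  by have := covR _ (subMR _ (fM e eE)); rewrite /= (negPf eB).
(* Since [#|E :&: B| <= #|B|] and [#|E :\: B| <= #|D|], equality holds in both. *)
have leBD : #|B| + #|D| <= #|E :&: B| + #|E :\: B| by rewrite cardsID cardE.
have BsubE : B \subset E.
  apply/setIidPr/eqP; rewrite eqEcard subsetIr /= -(leq_add2r #|D|).
  by apply: leq_trans leBD _; rewrite leq_add2l.
have leDE : #|D| <= #|E :\: B|.
  by move: leBD; rewrite (setIidPr BsubE) leq_add2l.
exists (RBGraph E_graph (fun e => e \notin B)); split.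
  move=> FE; apply: H_free; apply: contains_berge_of_matching f_inj _ FE.
  by move=> e /fP[].
(* Hyperedges in [D] are charged to red edges, the others to blue cliques. *)
rewrite /g_ -(cardsID D H); apply: leq_add.
  apply: leq_trans (subset_leq_card (subsetIr _ _)) (leq_trans leDE _).
  by apply/subset_leq_card/subsetP => e; rewrite !inE andbC.
apply: clique_leq_num_copies => [h|h e] /setDP[hH hD].
  by apply/eqP; have /forall_inP := H_uniform; apply.
move=> card_e sub_eh; have := covR (e, h); rewrite !inE /= card_e hH sub_eh.
rewrite (negPf hD) orbF negbK => /(_ isT) eB.
by rewrite (subsetP BsubE) // eB.
Qed.
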